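(* Let $K$ be a commutative, idempotent, totally ordered semifield and let $E$ be a free $K$-module of rank $n$ with basis $B=(e_i)_{1\le i\le n}$. Every regular family $(f_i)_{1\le i\le p}$ of elements of $E$ can be completed to a tropical basis of $E$ by adjoining $n-p$ vectors chosen in $B$.
   Context: A commutative idempotent semifield is a set $K$ with commutative associative operations $+$ and $\cdot$, with neutral elements $0\ne 1$, $\cdot$ distributive over $+$, $0$ absorbing, every nonzero element multiplicatively invertible, and $x+x=x$ for all $x$. It is ordered by $a\le b \iff a+b=b$; it is totally ordered if this order is total (so $a+b=\max(a,b)$). A free $K$-module of rank (dimension) $n$ is a module with a basis of $n$ elements, i.e. isomorphic to $K^n$. For modules $E,F$, $L(E,F)$ is the module of linear maps with pointwise operations, and $E^*=L(E,K)$. In a commutative monoid $(M,+,0)$, $x\perp y$ (orthogonal) means: $x+z=x$ and $y+z=y$ imply $z=0$. (For elements of a free $K$-module, or for linear maps between free modules of finite rank viewed as matrices, this means disjoint supports.) Write $x=x_1\bigoplus x_2$ if $x=x_1+x_2$ and $x_1\perp x_2$. For a linear map $f:E\to F$: a point $u\in E$ is singular for $f$ if there is a decomposition $f=f_1\bigoplus f_2$ in $L(E,F)$ with $f_1(u)=f_2(u)$; $Tker(f)$ is the set of singular points, and $f$ is regular if $Tker(f)=\{0\}$. A point $u\in E$ is *singular for $f$ (equivalently $f$ is *singular at $u$) if there is a decomposition $u=u_1\bigoplus u_2$ in $E$ with $f(u_1)=f(u_2)$; $Ker^*(f)$ is the set of such points. A family $(f_i)_{i\in I}$ in $E$ is regular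 if the linear map $K^{(I)}\to E$, $(\lambda_i)\mapsto\sum\lambda_i f_i$, is regular. The submodule weakly (or tropically) generated by $(f_i)$ is the intersection of the $Ker^* l$ over all $l\in E^*$ such that every element of $\sum_i Kf_i$ lies in $Ker^* l$. The family is weakly generating for a submodule $F$ of $E$ if $F$ is equal to this intersection (for $F=E$: the only linear form on $E$ that is *singular at every point of $\sum_i Kf_i$ is $0$). A tropical basis of a submodule $F$ is a regular family that is weakly generating for $F$. *)

(* Defs.v *)
From HB Require Import structures.
From mathcomp Require Import all_boot all_algebra.
From mathcomp Require Import boolp classical_sets.

Set Implicit Arguments.
Unset Strict Implicit.
Unset Printing Implicit Defensive.

Import GRing.Theory.
Local Open Scope classical_set_scope.
Local Open Scope ring_scope.

(* 0 <> 1 and the absorption law are part of comNzSemiRingType. *)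
Definition idempotent_semifield (K : comNzSemiRingType) : Prop :=
  (forall x : K, x != 0 -> exists y : K, x * y = 1) /\
  (forall x : K, x + x = x).

Definition idem_le (M : nmodType) (a b : M) : Prop := a + b = b.

Definition totally_ordered (M : nmodType) : Prop :=
  forall a b : M, idem_le a b \/ idem_le b a.

(* The additive monoid L(E, F), with pointwise operations. *)
Section LinearMaps.
Context (K : comNzSemiRingType) (E F : lSemiModType K).

Lemma linear_map_ext (f g : {linear E -> F}) : f =1 g -> f = g.
Proof.
case: f g => [f [[f1] [f2]]] [g [[g1] [g2]]] /= /funext efg.
by subst g; rewrite (Prop_irrelevance f1 g1) (Prop_irrelevance f2 g2).
Qed.

HB.instance Definition _ := gen_eqMixin {linear E -> F}.
HB.instance Definition _ := gen_choiceMixin {linear E -> F}.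

Definition lin_zero : {linear E -> F} := \0.
Definition lin_add (f g : {linear E -> F}) : {linear E -> F} := f \+ g.

Lemma lin_addA : associative lin_add.
Proof. by move=> f g h; apply: linear_map_ext => x /=; rewrite addrA. Qed.

Lemma lin_addC : commutative lin_add.
Proof. by move=> f g; apply: linear_map_ext => x /=; rewrite addrC. Qed.

Lemma lin_add0 : left_id lin_zero lin_add.
Proof. by move=> f; apply: linear_map_ext => x /=; rewrite add0r. Qed.

HB.instance Definition _ :=
  GRing.isNmodule.Build {linear E -> F} lin_addA lin_addC lin_add0.

End LinearMaps.

Section Orthogonality.
Context (M : nmodType).

Definition orthogonal (x y : M) : Prop :=
  forall z : M, x + z = x -> y + z = y -> z = 0.

Definition orthogonal_sum (x x1 x2 : M) : Prop :=
  x = x1 + x2 /\ orthogonal x1 x2.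

End Orthogonality.

Section Singular.
Context (K : comNzSemiRingType) (E F : lSemiModType K).

Definition Tker (f : {linear E -> F}) : set E :=
  [set u | exists f1 f2 : {linear E -> F},
             orthogonal_sum f f1 f2 /\ f1 u = f2 u].

Definition regular_map (f : {linear E -> F}) : Prop := Tker f = [set 0].

Definition Ker_star (f : {linear E -> F}) : set E :=
  [set u | exists u1 u2 : E, orthogonal_sum u u1 u2 /\ f u1 = f u2].

End Singular.

Section Families.
Context (K : comNzSemiRingType) (E : lSemiModType K) (I : finType).

(* As I is finite, K^(I) is {ffun I -> K^o}, where K^o is K seen as a module
   over itself. *)
Definition lincomb (f : I -> E) (c : {ffun I -> K^o}) : E :=
  \sum_i (c i : K) *: f i.

Lemma lincomb_semilinear (f : I -> E) : semilinear (lincomb f).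
Proof.
split=> [a c|c d]; rewrite /lincomb.
  by rewrite scaler_sumr; apply: eq_bigr => i _; rewrite ffunE scalerA.
by rewrite -big_split; apply: eq_bigr => i _; rewrite ffunE scalerDl.
Qed.

HB.instance Definition _ (f : I -> E) :=
  GRing.isSemilinear.Build K {ffun I -> K^o} E *:%R (lincomb f)
    (lincomb_semilinear f).

Definition is_basis (e : I -> E) : Prop := bijective (lincomb e).

Definition regular_family (f : I -> E) : Prop :=
  regular_map (lincomb f : {linear {ffun I -> K^o} -> E}).

(* range (lincomb f) is the submodule \sum_i K f_i. *)
Definition weak_span (f : I -> E) : set E :=
  \bigcap_(l in [set l : {linear E -> K^o} | range (lincomb f) `<=` Ker_star l])
    Ker_star l.

Definition weakly_generating (f : I -> E) (F : set E) : Prop :=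
  F = weak_span f.

Definition tropical_basis (f : I -> E) (F : set E) : Prop :=
  regular_family f /\ weakly_generating f F.

End Families.

Definition family_cat (E I J : Type) (f : I -> E) (g : J -> E) (k : I + J) : E :=
  match k with inl i => f i | inr j => g j end.

(* Main.v *)
(* In coordinates, u is a singular point of f when in every row of the matrix A
   of f the maximum of the terms A i j * u j is 0 or attained twice, and a linear
   form l is *singular at every f j when l satisfies the same condition for the
   transpose of A.  Hence it suffices to find p rows on which A becomes, after
   permuting and scaling, triangular among its entries equal to 1, with diagonal
   1 and all entries at most 1: such a square matrix and its transpose have only
   trivial singular points, and the vectors e i for the other rows i complete f.

   The rows are found by induction on the number of columns and rows, following
   Grigoriev's algorithm for tropical linear systems.  Start from u with full
   support solving all rows but m, the maximum in row m being attained only at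
   column j1.  Starting from {j1}, enlarge a set T of columns: a row whose maximum
   is attained at exactly one column outside T puts that column into T.  If T
   becomes the set of all columns, the rows used form the triangular matrix.
   Otherwise multiply the u j outside T by the least scalar that creates a new
   tie and start again. *)
Require Import Defs.
From HB Require Import structures.
From mathcomp Require Import all_boot all_algebra.
From mathcomp Require Import boolp classical_sets.

Set Implicit Arguments.
Unset Strict Implicit.
Unset Printing Implicit Defensive.

Import GRing.Theory.
Local Open Scope ring_scope.

Section Semifield.
Context (K : comNzSemiRingType).
Hypotheses (K_semifield : idempotent_semifield K) (K_total : totally_ordered K).

(** * The order of the semifield and finite maxima *)

Definition le_idem (a b : K) : bool := a + b == b.
Local Notation "a <=+ b" := (le_idem a b) (at level 70, no associativity).

Lemma le_idem_refl : reflexive le_idem.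
Proof. by move=> a; rewrite /le_idem K_semifield.2. Qed.

Lemma le_idem_trans : transitive le_idem.
Proof. by move=> b a c /eqP ab /eqP bc; rewrite /le_idem -bc addrA ab. Qed.

Lemma le_idem_anti : antisymmetric le_idem.
Proof. by move=> a b /andP[/eqP ab /eqP ba]; rewrite -ab addrC ba. Qed.

Lemma le_idem_total : total le_idem.
Proof.
by move=> a b; case: (K_total a b) => /eqP h; apply/orP; [left | right].
Qed.

Lemma nle_idem_le a b : ~~ (a <=+ b) -> b <=+ a.
Proof. by case/orP: (le_idem_total a b) => [->|]. Qed.

Lemma le0_idem a : 0 <=+ a.
Proof. by rewrite /le_idem add0r. Qed.

Lemma le_idem0 a : a <=+ 0 -> a = 0.
Proof. by rewrite /le_idem addr0 => /eqP. Qed.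

Lemma le_idem_neq0 a b : a <=+ b -> a != 0 -> b != 0.
Proof. by move=> ab; apply: contra_neq => b0; apply: le_idem0; rewrite -b0. Qed.

Lemma le_idem_mul2l c a b : a <=+ b -> c * a <=+ c * b.
Proof. by move=> /eqP ab; rewrite /le_idem -mulrDr ab. Qed.

Lemma le_idem_mul2r c a b : a <=+ b -> a * c <=+ b * c.
Proof. by rewrite ![_ * c]mulrC; apply: le_idem_mul2l. Qed.

Lemma idem_mulI (c : K) : c != 0 -> injective (fun x : K => c * x).
Proof.
move=> /K_semifield.1[d cd] a b /(congr1 (fun x => d * x)).
by rewrite !mulrA ![d * c]mulrC cd !mul1r.
Qed.

Lemma le_idem_mulI c a b : c != 0 -> c * a <=+ c * b -> a <=+ b.
Proof.
by move=> c0; rewrite /le_idem -mulrDr => /eqP /(idem_mulI c0) ->.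
Qed.

Lemma idem_mulf_neq0 (a b : K) : (a * b != 0) = (a != 0) && (b != 0).
Proof.
apply/idP/andP => [ab | [a0]].
  by split; apply: contra_neq ab => ->; rewrite ?mul0r ?mulr0.
by apply: contra_neq => ab; apply: (idem_mulI a0) => /=; rewrite ab mulr0.
Qed.

Lemma le_idem_addl (a b : K) : a <=+ a + b.
Proof. by rewrite /le_idem addrA K_semifield.2. Qed.

Lemma le_idem_addr (a b : K) : b <=+ a + b.
Proof. by rewrite addrC le_idem_addl. Qed.

Lemma add_le_idem a b c : a <=+ c -> b <=+ c -> a + b <=+ c.
Proof. by move=> /eqP ac /eqP bc; rewrite /le_idem -addrA bc ac. Qed.

Lemma le_idem_sum (T : finType) (F : T -> K) t : F t <=+ \sum_s F s.
Proof. by rewrite (bigD1 t) //= le_idem_addl. Qed.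

Lemma sum_le_idem (T : finType) (F : T -> K) c :
  (forall t, F t <=+ c) -> \sum_s F s <=+ c.
Proof.
move=> Fc; apply: (big_ind (fun x => x <=+ c)) => [|a b|t _].
- exact: le0_idem.
- exact: add_le_idem.
- exact: Fc.
Qed.

Lemma exists_le_idem_max (T : finType) (P : pred T) (F : T -> K) t0 :
  P t0 -> exists2 t, P t & forall s, P s -> F s <=+ F t.
Proof.
move=> Pt0.
case: (@extremumP K T (fun a b => b <=+ a) t0 P F) => //.
- exact: le_idem_refl.
- by move=> b a c /= ba cb; apply: le_idem_trans cb ba.
- by move=> a b; apply: le_idem_total.
by move=> t; exists t.
Qed.

Lemma exists_le_idem_min (T : finType) (P : pred T) (F : T -> K) t0 :
  P t0 -> exists2 t, P t & forall s, P s -> F t <=+ F s.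
Proof.
move=> Pt0; case: (@extremumP K T le_idem t0 P F) => //.
- exact: le_idem_refl.
- exact: le_idem_trans.
- exact: le_idem_total.
by move=> t; exists t.
Qed.

Lemma sum_idem_attained (T : finType) (F : T -> K) :
  \sum_s F s != 0 -> exists t, \sum_s F s = F t.
Proof.
move=> F0; have [t0 _|T0] := pickP (fun _ : T => true); last first.
  by move: F0; rewrite big_pred0 ?eqxx.
have [t _ tP] := @exists_le_idem_max T xpredT F t0 isT.
exists t; apply: le_idem_anti.
by rewrite le_idem_sum andbT sum_le_idem // => s; apply: tP.
Qed.

(** The least of the quotients [y t / x t] over the finitely many nonzero [x t] works. It serves to
    scale one vector down until it does not disturb another. *)
Lemma exists_small_scalar (T : finType) (x y : T -> K) :
  (forall t, y t != 0) -> exists2 c, c != 0 & forall t, c * x t <=+ y t.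
Proof.
move=> y0; suff [c c0 cP] : exists2 c, c != 0 &
    forall t, t \in enum T -> c * x t <=+ y t.
  by exists c => // t; apply: cP; rewrite mem_enum.
elim: (enum T) => [|t s [c c0 cP]]; first by exists 1; rewrite ?oner_neq0.
have [d d0 dt] : exists2 d, d != 0 & d * x t <=+ y t.
  have [xt0|] := eqVneq (x t) 0.
    by exists 1; rewrite ?oner_neq0 // xt0 mulr0 le0_idem.
  move=> /K_semifield.1[z xz]; exists (y t * z); last first.
    by rewrite -mulrA [z * _]mulrC xz mulr1 le_idem_refl.
  rewrite idem_mulf_neq0 y0 /=; apply: contra_eq_neq xz => ->.
  by rewrite mulr0 eq_sym oner_neq0.
case/orP: (le_idem_total c d) => cd; [exists c | exists d] => // t';
  rewrite inE => /orP[/eqP->|ts].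
- by apply: le_idem_trans dt; apply: le_idem_mul2r.
- exact: cP.
- exact: dt.
- by apply: le_idem_trans (cP _ ts); apply: le_idem_mul2r.
Qed.

(** * Balanced families and nonsingular rows *)

(** Equivalent to the maximum of [x] being 0 or attained at least twice, since the condition is
    automatic at an index where the maximum is not attained. *)
Definition balanced (T : finType) (x : T -> K) : Prop :=
  forall j, x j != 0 -> exists2 k, k != j & x j <=+ x k.

(** A nonzero entry of one part is at most the common sum, which is an entry of the other part;
    disjointness of supports makes the two indices distinct. *)
Lemma balanced_add (T : finType) (x y : T -> K) :
  (forall j, x j = 0 \/ y j = 0) -> \sum_j x j = \sum_j y j ->
  balanced (fun j => x j + y j).
Proof.
move=> xy sxy.
suff dom (x' y' : T -> K) : (forall j, x' j = 0 \/ y' j = 0) ->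
    \sum_j x' j = \sum_j y' j -> forall j, y' j = 0 -> x' j != 0 ->
    exists2 k, k != j & x' j <=+ y' k.
  move=> j nz; case: (xy j) => h0.
    have yx i : y i = 0 \/ x i = 0 by case: (xy i); [right | left].
    have [|k kj le_jk] := dom y x yx (esym sxy) j h0.
      by rewrite h0 add0r in nz.
    by exists k => //; rewrite h0 add0r; apply: le_idem_trans le_jk (le_idem_addl _ _).
  have [|k kj le_jk] := dom x y xy sxy j h0; first by rewrite h0 addr0 in nz.
  by exists k => //; rewrite h0 addr0; apply: le_idem_trans le_jk (le_idem_addr _ _).
move=> {x y}xy {}sxy j yj0 xj0.
have ley : x' j <=+ \sum_k y' k by rewrite -sxy le_idem_sum.
have [k yk] := sum_idem_attained (le_idem_neq0 ley xj0).
exists k; last by rewrite -yk.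
by apply: contra_neq xj0 => kj; apply: le_idem0; rewrite -yj0 -{2}kj -yk.
Qed.

Section Matrix.
Context (I J : finType) (A : I -> J -> K).
Implicit Types (R : {set I}) (S T : {set J}) (u v : J -> K).

Definition solves R u : Prop :=
  forall i, i \in R -> balanced (fun j => A i j * u j).

Definition trivial_kernel R S : Prop :=
  forall u, (forall j, j \notin S -> u j = 0) -> solves R u -> forall j, u j = 0.

(* After scaling the columns by [v] and the rows [rho j] suitably, the square
   matrix (A (rho j) k) has diagonal 1 and entries at most 1, those equal to 1
   being triangular for the order given by [r]. *)
Definition nonsingular_rows R S (rho : J -> I) : Prop :=
  exists (v : J -> K) (r : J -> nat), forall j, j \in S ->
    [/\ rho j \in R, A (rho j) j != 0, v j != 0
      & forall k, k \in S -> k != j ->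
          A (rho j) k * v k <=+ A (rho j) j * v j /\
          (A (rho j) j * v j <=+ A (rho j) k * v k -> (r k < r j)%N)].

(** In a row shared by columns [j] and [k] each diagonal term dominates the other, so they tie and
    [r] decreases strictly both ways. *)
Lemma nonsingular_rows_inj R S rho :
  nonsingular_rows R S rho -> {in S &, injective rho}.
Proof.
move=> [v [r cert]] j k jS kS jk; apply/eqP/negPn/negP => njk.
have [_ _ _ /(_ k kS)] := cert j jS; rewrite eq_sym => /(_ njk)[le1 lt1].
have [_ _ _ /(_ j jS njk)] := cert k kS; rewrite -jk => -[le2 lt2].
by have := ltn_trans (lt1 le2) (lt2 le1); rewrite ltnn.
Qed.

(** Among the columns where [u / v] is maximal, take [j] with [r j] least. Balance of row [rho j]
    gives a second column [k] where [u / v] is maximal and the scaled entries tie, so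
    [r k < r j]. *)
Lemma nonsingular_kernel R S rho u : nonsingular_rows R S rho ->
  (forall j, j \notin S -> u j = 0) ->
  (forall j, j \in S -> balanced (fun k => A (rho j) k * u k)) ->
  forall j, u j = 0.
Proof.
move=> [v [r cert]] uS ubal j0; apply/eqP/negPn/negP => uj0.
have inS j : u j != 0 -> j \in S by apply: contraR => /uS/eqP.
(* [x] is the quotient of [u] by [v], set to 0 outside [S]. *)
have /choice[x xP] : forall j, exists c, u j = c * v j.
  move=> j; have [jS|/uS ->] := boolP (j \in S); last by exists 0; rewrite mul0r.
  have [_ _ /K_semifield.1[w vw] _] := cert j jS.
  by exists (u j * w); rewrite -mulrA [w * _]mulrC vw mulr1.
have [j1 j1u j1max] := @exists_le_idem_max J [pred j | u j != 0] x j0 uj0.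
pose P := [pred j | (u j != 0) && (x j1 <=+ x j)].
have Pj1 : P j1 by rewrite /= [_ && _]andbC le_idem_refl.
case: (arg_minnP r Pj1) => j /andP[ju j1j] jmin.
have [_ Ajj vj jk] := cert j (inS j ju).
have [|k kj lek] := ubal j (inS j ju) j; first by rewrite idem_mulf_neq0 Ajj.
have ku : u k != 0.
  apply: contraTneq isT => uk0; move: lek; rewrite uk0 mulr0 => /le_idem0/eqP.
  by rewrite -[_ == 0]negbK idem_mulf_neq0 Ajj ju.
have [le1 lt1] := jk k (inS k ku) kj.
rewrite !xP in lek.
have xjk : x j <=+ x k.
  apply: (@le_idem_mulI (A (rho j) j * v j)); first by rewrite idem_mulf_neq0 Ajj.
  rewrite -!mulrA ![v _ * _]mulrC; apply: le_idem_trans lek _.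
  by rewrite mulrCA [X in _ <=+ X]mulrCA; apply: le_idem_mul2l.
have Pk : P k by rewrite /= ku (le_idem_trans j1j xjk).
have := jmin k Pk; rewrite leqNgt lt1 //.
have xkj : x k <=+ x j by apply: le_idem_trans j1j; apply: j1max.
have xk0 : x k != 0 by apply: contra_neq ku => xk0; rewrite xP xk0 mul0r.
apply: (le_idem_mulI xk0); rewrite !(mulrCA (x k)); apply: le_idem_trans lek.
by apply: le_idem_mul2l; apply: le_idem_mul2r.
Qed.

(** Transpose of the preceding argument: ties now occur within a column, so the rank [r] is taken
    greatest instead of least. *)
Lemma nonsingular_cokernel R rho (l : I -> K) : nonsingular_rows R finset.setT rho ->
  (forall i, (forall j, rho j != i) -> l i = 0) ->
  (forall j, balanced (fun i => l i * A i j)) ->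
  forall i, l i = 0.
Proof.
move=> cert; have rinj := nonsingular_rows_inj cert.
case: cert => v [r cert] lout lbal i0; apply/eqP/negPn/negP => li0.
have inrho i : l i != 0 -> exists j, i = rho j.
  move=> li; have [j /eqP <-|nj] := pickP (fun j => rho j == i); first by exists j.
  by rewrite lout ?eqxx // in li => j; rewrite nj.
have [j0 ij0] := inrho i0 li0; subst i0.
pose x j := l (rho j) * (A (rho j) j * v j).
have [j1 j1u j1max] := @exists_le_idem_max J [pred j | l (rho j) != 0] x j0 li0.
pose P := [pred j | (l (rho j) != 0) && (x j1 <=+ x j)].
have Pj1 : P j1 by rewrite /= [_ && _]andbC le_idem_refl.
case: (arg_maxnP r Pj1) => j /andP[ju j1j] jmax.
have [_ Ajj vj _] := cert j (finset.in_setT j).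
have [|i ij lei] := lbal j (rho j); first by rewrite idem_mulf_neq0 Ajj ju.
have lA : l (rho j) * A (rho j) j != 0 by rewrite idem_mulf_neq0 ju.
have := le_idem_neq0 lei lA; rewrite idem_mulf_neq0 => /andP[li Aij].
have [k ik] := inrho i li; subst i.
have jk : j != k by apply: contra_neq ij => ->.
have [_ Akk vk /(_ j (finset.in_setT j) jk) [le1 lt1]] := cert k (finset.in_setT k).
have lej : x j <=+ l (rho k) * (A (rho k) j * v j).
  by rewrite /x !mulrA; apply: le_idem_mul2r.
have xjk : x j <=+ x k by apply: le_idem_trans lej _; apply: le_idem_mul2l.
have Pk : P k by rewrite /= li (le_idem_trans j1j xjk).
have /= := jmax k Pk; rewrite leqNgt lt1 //.
apply: (le_idem_mulI li); apply: le_idem_trans lej.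
exact: le_idem_trans (j1max k li) j1j.
Qed.

(** * Grigoriev's algorithm *)

(* Sums in [K] are maxima. *)
Definition row_max u i : K := \sum_j A i j * u j.

(** Requiring a nonzero term keeps zero rows, and columns outside the support of [u], isolated in
    the graph. *)
Definition attains u i j : bool :=
  (A i j * u j != 0) && (row_max u i <=+ A i j * u j).

Lemma le_row_max u i j : A i j * u j <=+ row_max u i.
Proof. exact: (le_idem_sum (fun k => A i k * u k)). Qed.

Lemma attains_row_max u i j : attains u i j -> A i j * u j = row_max u i.
Proof. by case/andP=> _ le; apply: le_idem_anti; rewrite le_row_max. Qed.

Lemma attains_max u i j k : attains u i j -> A i k * u k <=+ A i j * u j.
Proof. by move/attains_row_max->; apply: le_row_max. Qed.

Lemma attains_neq0 u i j : attains u i j -> u j != 0.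
Proof. by case/andP; rewrite idem_mulf_neq0 => /andP[]. Qed.

Lemma attainsI u i j : A i j * u j != 0 ->
  (forall k, A i k * u k <=+ A i j * u j) -> attains u i j.
Proof. by move=> nz le; rewrite /attains nz sum_le_idem. Qed.

Lemma exists_attains u i : row_max u i != 0 -> exists j, attains u i j.
Proof.
move=> nz; have [j ej] := sum_idem_attained nz; exists j.
by rewrite /attains -ej nz le_idem_refl.
Qed.

Lemma balanced_attains u i j : balanced (fun k => A i k * u k) ->
  attains u i j -> exists2 k, k != j & attains u i k.
Proof.
move=> bal att; have /andP[nz le] := att.
have [k kj lek] := bal j nz; exists k => //.
by rewrite /attains (le_idem_neq0 lek nz) (le_idem_trans le lek).
Qed.

Lemma not_balanced_attains u i : ~ balanced (fun k => A i k * u k) ->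
  exists2 j, attains u i j & forall k, attains u i k -> k = j.
Proof.
move=> nbal.
have [j [nz jP]] : exists j, A i j * u j != 0 /\
    forall k, k != j -> ~~ (A i j * u j <=+ A i k * u k).
  apply: contrapT => no; apply: nbal => j nz; apply: contrapT => nk.
  apply: no; exists j; split=> // k kj; apply/negP => le.
  by apply: nk; exists k.
have att : attains u i j.
  apply: attainsI => // k; have [->|/jP] := eqVneq k j; first exact: le_idem_refl.
  exact: nle_idem_le.
exists j => // k attk; apply/eqP/negPn/negP => /jP/negP; apply.
exact: attains_max attk.
Qed.

Definition nearly_solves R S m j1 u : Prop :=
  [/\ forall j, (u j != 0) = (j \in S), solves (R :\ m) u, attains u m j1
    & forall k, attains u m k -> k = j1].

(* The last condition says that [T] lies in the connected component of [j1] in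
   the bipartite graph [attains u]. *)
Definition forced R j1 u T : Prop :=
  [/\ j1 \in T,
      exists (rho : J -> I) (r : J -> nat), forall j, j \in T ->
        [/\ rho j \in R, attains u (rho j) j
          & forall k, k != j -> attains u (rho j) k -> k \in T /\ (r k < r j)%N]
    & forall D : {set J}, j1 \in D ->
        (forall i j k, j \in D -> attains u i j -> attains u i k -> k \in D) ->
        T \subset D].

Lemma forced1 R S m j1 u : m \in R -> nearly_solves R S m j1 u ->
  forced R j1 u [set j1]%SET.
Proof.
move=> mR [_ _ att uniq]; split=> [||D j1D _]; first by rewrite inE.
- exists (fun=> m), (fun=> 0%N) => j; rewrite inE => /eqP->.
  by split=> // k kj1 /uniq ek; rewrite ek eqxx in kj1.
- by rewrite finset.sub1set.
Qed.

(** Column [k] receives row [i] and a rank above all earlier ones. As row [i] is balanced, its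
    maximum is also attained in [T], which links [k] to the component of [j1]. *)
Lemma forced_extend R m j1 u T i k : solves (R :\ m) u -> forced R j1 u T ->
  i \in R :\ m -> k \notin T -> attains u i k ->
  (forall k', k' != k -> attains u i k' -> k' \in T) -> forced R j1 u (k |: T).
Proof.
move=> sol [j1T [rho [r rhoP]] Tmin] iRm kT att onlyk; split.
- by rewrite !inE j1T orbT.
- exists (fun j => if j == k then i else rho j).
  exists (fun j => if j == k then (\max_j' r j').+1 else r j) => j.
  rewrite !inE; case: eqVneq => [-> _|jk /= jT].
    split=> // [|k' k'k att']; first by move: iRm; rewrite !inE => /andP[].
    rewrite !inE (negPf k'k) onlyk //; split=> //.
    by rewrite ltnS; apply: (leq_bigmax k').
  have [rR attj jP] := rhoP j jT; split=> // k' k'j att'.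
  have [k'T ltr] := jP k' k'j att'; rewrite !inE k'T orbT; split=> //.
  by rewrite (negPf (contraTneq _ kT)) // => <-; rewrite negbK.
- move=> D j1D Dcl; have TD := Tmin D j1D Dcl.
  rewrite finset.subUset finset.sub1set TD andbT.
  have [k' k'k att'] := balanced_attains (sol i iRm) att.
  apply: (Dcl i k' k) => //; apply: (fintype.subsetP TD); exact: onlyk.
Qed.

(** The vector [u] itself is the column scaling: the entries tying with the diagonal are those where
    the row maximum is attained. *)
Lemma forced_full R S j1 u : (forall j, (u j != 0) = (j \in S)) ->
  forced R j1 u S -> exists rho, nonsingular_rows R S rho.
Proof.
move=> uS [_ [rho [r rhoP]] _]; exists rho, u, r => j jS.
have [rR att jP] := rhoP j jS; rewrite uS; split=> // [|k kS kj].
  by case/andP: att; rewrite idem_mulf_neq0 => /andP[].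
split=> [|le]; first exact: attains_max.
apply: (jP k kj _).2; case/andP: att => nz max.
by rewrite /attains (le_idem_neq0 le nz) (le_idem_trans max le).
Qed.

(* [u'] multiplies [u] outside [T] by the least scalar creating a tie between [T]
   and its complement.  The last clause says that the graph [attains u] never
   recurs, which is what makes the iteration terminate without any archimedean
   assumption on [K]. *)
Lemma raise_nearly_solution R S m j1 u T : m \in R -> trivial_kernel R S ->
  nearly_solves R S m j1 u -> forced R j1 u T -> T != S ->
  (forall k, k \notin T -> ~ forced R j1 u (k |: T)) ->
  exists u', [/\ nearly_solves R S m j1 u', forall j, u j <=+ u' j, u' j1 = u j1
    & forall u'', (forall j, u' j <=+ u'' j) -> u'' j1 = u j1 ->
        ~ (forall i j, attains u'' i j = attains u i j)].
Proof.
move=> mR triv [uS sol attm uniqm] forcedT TS Tmax.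
have [j1T [rho [r rhoP]] Tmin] := forcedT.
have TsubS j : j \in T -> j \in S.
  by move=> /rhoP[_ /attains_neq0]; rewrite uS.
have stuck i k : i \in R :\ m -> k \notin T -> attains u i k ->
    exists k', [/\ k' != k, k' \notin T & attains u i k'].
  move=> iRm kT att; apply: contrapT => no; apply: (Tmax k kT).
  apply: forced_extend iRm kT att _ => // k' k'k att'.
  by apply/negPn/negP => k'T; apply: no; exists k'.
(* The rows whose maximum is attained only in [T]; only these limit the raising of the columns
   outside [T]. *)
pose inT i := [forall k, attains u i k ==> (k \in T)].
have inTP i k : inT i -> attains u i k -> k \in T by move=> /forallP/(_ k)/implyP.
have inTm : inT m by apply/forallP => k; apply/implyP => /uniqm->.
have ninT i : ~~ inT i -> i \in R ->
    exists k, [/\ i \in R :\ m, k \notin T & attains u i k].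
  move=> iT iR; have /forallPn[k] := iT; rewrite negb_imply => /andP[att kT].
  exists k; split=> //; rewrite !inE iR andbT.
  by apply: contraNneq iT => ->.
have [j2 j2S j2T] : exists2 j, j \in S & j \notin T.
  apply: contrapT => no; move/negP: TS; apply; rewrite finset.eqEsubset.
  apply/andP; split; apply/fintype.subsetP => j; first exact: TsubS.
  by move=> jS; apply/negPn/negP => jT; apply: no; exists j.
pose P := [pred x : I * J | [&& x.1 \in R, x.2 \in S, x.2 \notin T,
  A x.1 x.2 != 0 & inT x.1]].
have [x0 Px0|noP] := pickP P; last first.
  (* If no row limits the raising, the restriction of [u] to the complement of [T] solves all rows
     of [R]: each row it meets has its maximum attained twice outside [T]. This contradicts the
     trivial kernel. *)
  pose w j := if j \in T then 0 else u j.
  have w0 : forall j, w j = 0.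
    apply: (triv w) => [j|i iR j].
      by rewrite /w -uS negbK; case: ifP => // _ /eqP.
    rewrite {1}/w; case: ifPn => [_|jT]; first by rewrite mulr0 eqxx.
    rewrite idem_mulf_neq0 => /andP[Aij]; rewrite uS => jS.
    have := noP (i, j); rewrite /= iR jS jT Aij /= => /negbT iT.
    have [k [iRm kT att]] := ninT i iT iR.
    have [e [ej eT atte]] : exists e, [/\ e != j, e \notin T & attains u i e].
      have [ekj|kj] := eqVneq k j; last by exists k.
      by have := stuck i j iRm jT; rewrite -{1}ekj => /(_ att).
    by exists e => //; rewrite /w (negPf jT) (negPf eT); apply: attains_max.
  by have /eqP := w0 j2; rewrite /w (negPf j2T) -[_ == 0]negbK uS j2S.
(* [t (i, j)] is the factor that lifts the term at [(i, j)] to the maximum of row [i]. The least one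
   over [P] is the scalar [c], found at [(i0, k0)]. *)
have /choice[t tP] : forall x : I * J, exists c,
    A x.1 x.2 * u x.2 != 0 -> c * (A x.1 x.2 * u x.2) = row_max u x.1.
  move=> x; have [->|/K_semifield.1[d dP]] := eqVneq (A x.1 x.2 * u x.2) 0.
    by exists 0.
  by exists (row_max u x.1 * d) => _; rewrite -mulrA [d * _]mulrC dP mulr1.
have [[i0 k0] /= P0 tmin] := exists_le_idem_min t Px0.
have {P0} /and5P[i0R k0S k0T A0 i0T] := P0.
have nz0 : A i0 k0 * u k0 != 0 by rewrite idem_mulf_neq0 A0 uS.
move: (tmin) (tP (i0, k0) nz0) => {}tmin /=; set c := t (i0, k0) => cP.
have lev0 : row_max u i0 != 0 := le_idem_neq0 (le_row_max u i0 k0) nz0.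
have c0 : c != 0 by apply: contra_neq lev0 => c0; rewrite -cP c0 mul0r.
have c1 : 1 <=+ c.
  apply/negPn/negP => /nle_idem_le/(le_idem_mul2r (A i0 k0 * u k0)).
  rewrite cP mul1r => le; apply: (negP k0T); apply: inTP i0T _.
  by rewrite /attains nz0.
have leM x : x <=+ c * x by rewrite -[X in X <=+ _]mul1r le_idem_mul2r.
pose u' j := if j \in T then u j else c * u j.
have u'T j : j \in T -> u' j = u j by rewrite /u' => ->.
have u'C j : j \notin T -> u' j = c * u j by rewrite /u' => /negPf->.
have u'S j : (u' j != 0) = (j \in S).
  by rewrite /u' -uS; case: ifP => //; rewrite idem_mulf_neq0 c0.
have le_u' j : u j <=+ u' j.
  by rewrite /u'; case: ifP => // _; apply: le_idem_refl.
have le_in i k : i \in R -> inT i -> A i k * u' k <=+ row_max u i.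
  move=> iR iT; have [kT|kT] := boolP (k \in T); first by rewrite u'T ?le_row_max.
  have [nz|] := boolP (A i k * u k != 0); last first.
    by rewrite u'C // mulrCA negbK => /eqP->; rewrite mulr0 le0_idem.
  rewrite u'C // mulrCA -(tP (i, k) nz) /=; apply/le_idem_mul2r/tmin.
  by move: nz; rewrite idem_mulf_neq0 uS => /andP[Aik kS]; rewrite /= iR kS kT Aik.
(* Rows with [inT] keep their ties in [T], by the choice of [c]. Every other row has two maxima
   outside [T], which are both multiplied by [c] and stay maximal because [c] is at least 1. *)
have sol' : solves (R :\ m) u'.
  move=> i iRm j nz'.
  have nz : A i j * u j != 0.
    by move: nz'; rewrite !idem_mulf_neq0 u'S uS.
  have lev : row_max u i != 0 := le_idem_neq0 (le_row_max u i j) nz.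
  have iR : i \in R by move: iRm; rewrite !inE => /andP[].
  have [iT|iT] := boolP (inT i).
    have [e ej att] : exists2 e, e != j & attains u i e.
      have [e att] := exists_attains lev.
      have [ee|ej] := eqVneq e j; last by exists e.
      by rewrite ee in att; apply: balanced_attains att; apply: sol.
    exists e => //; rewrite (u'T e) ?(inTP _ _ iT) // (attains_row_max att).
    exact: le_in.
  have [k [_ kT att]] := ninT i iT iR.
  have [e [ej eT atte]] : exists e, [/\ e != j, e \notin T & attains u i e].
    have [ekj|kj] := eqVneq k j; last by exists k.
    by have [e [? ? ?]] := stuck i k iRm kT att; exists e; rewrite -ekj.
  exists e => //; rewrite (u'C e) // mulrCA (attains_row_max atte).
  have [jT|jT] := boolP (j \in T).
    by rewrite u'T //; apply: le_idem_trans (le_row_max _ _ _) (leM _).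
  by rewrite u'C // mulrCA; apply/le_idem_mul2l/le_row_max.
have attm' : attains u' m j1.
  apply: attainsI => [|k]; rewrite (u'T j1) //; first by case/andP: attm.
  by rewrite (attains_row_max attm) le_in.
exists u'; split=> //; last 1 first.
- move=> u'' u'u'' u''1 same.
  (* If the graphs agree, equality of [u''] and [u] propagates along the graph from [j1] to all of
     [T]. In row [i0] the maximum is then unchanged, but [u'' k0] is at least [c * u k0] and reaches
     it, although [k0] is not in [T]. *)
  pose D := [set j | u'' j == u j]%SET.
  have TD : T \subset D.
    apply: Tmin => [|i j k]; rewrite !inE ?u''1 // => /eqP ej attj attk.
    have Aik : A i k != 0 by case/andP: attk; rewrite idem_mulf_neq0 => /andP[].
    apply/eqP/(idem_mulI Aik) => /=.
    rewrite (attains_row_max attk) -(attains_row_max attj) -ej.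
    by rewrite !attains_row_max // same.
  have [e att] := exists_attains lev0.
  have eT : e \in T := inTP _ _ i0T att.
  have /eqP eD : u'' e == u e by have := fintype.subsetP TD e eT; rewrite inE.
  apply: (negP k0T); apply: inTP i0T _; rewrite -same.
  have le0 : row_max u'' i0 <=+ A i0 k0 * u'' k0.
    rewrite -(@attains_row_max u'' i0 e) ?same // eD (attains_row_max att) -cP.
    by rewrite mulrCA; apply: le_idem_mul2l; rewrite -u'C.
  apply/andP; split=> //; apply: le_idem_neq0 le0 _.
  by rewrite -(@attains_row_max u'' i0 e) ?same // eD (attains_row_max att).
- split=> // k attk.
  (* If row [m] were balanced, [u'] would solve all rows of [R] and hence vanish. *)
  have [|j attj uniqj] := @not_balanced_attains u' m; last first.
    by rewrite (uniqj k attk) (uniqj j1 attm').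
  move=> balm; have : u' j1 = 0; last first.
    by apply/eqP; rewrite u'T // (attains_neq0 attm).
  apply: (triv u') => [j|i iR]; first by rewrite -u'S negbK => /eqP.
  by have [->|im] := eqVneq i m; last by apply: sol'; rewrite !inE im.
- exact: u'T.
Qed.

(** Induction on the number of graphs of vectors that lie above [u] and agree with it at [j1].
    Raising [u] shrinks this finite set, which loses the graph of [u]. *)
Lemma nearly_solved_nonsingular R S m j1 u : m \in R -> trivial_kernel R S ->
  nearly_solves R S m j1 u -> exists rho, nonsingular_rows R S rho.
Proof.
move=> mR triv.
pose graph w := [set x : I * J | attains w x.1 x.2]%SET.
pose reach w := [set g | `[< exists w', [/\ forall j, w j <=+ w' j,
  w' j1 = w j1 & graph w' = g] >]]%SET.
have [N leN] := ubnP #|reach u|; elim: N => // N IH in u leN *.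
move=> near; have [uS _ _ _] := near.
have [T /maxsetP[/asboolP forcedT Tmax] _] :=
  @maxset_exists _ (fun T => `[< forced R j1 u T >]) [set j1]%SET
    (asboolT (forced1 mR near)).
have [TS|TS] := eqVneq T S; first by rewrite TS in forcedT; apply: forced_full forcedT.
have [|u' [near' leu u'1 new]] := raise_nearly_solution mR triv near forcedT TS.
  move=> k kT forcedk.
  have eT := Tmax (k |: T)%SET (asboolT forcedk) (finset.subsetUr _ _).
  by move: kT; rewrite -eT !inE eqxx.
apply: (IH u') near'; rewrite -ltnS; apply: leq_trans leN; rewrite ltnS.
apply: proper_card; apply/properP; split.
  apply/fintype.subsetP => g; rewrite !inE => -[w [lew w1 gw]].
  exists w; split=> // [j|]; last by rewrite w1.
  exact: le_idem_trans (leu j) (lew j).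
exists (graph u).
  by rewrite !inE; exists u; split=> // j; apply: le_idem_refl.
apply/negP; rewrite !inE => -[w [lew w1 gw]]; apply: (new w) => //; first by rewrite w1.
move=> i j; have := congr1 (fun g : {set I * J} => (i, j) \in g) gw.
by rewrite !inE.
Qed.

(** * Block decomposition and induction on columns and rows *)

Definition rows_vanishing_on R T : {set I} :=
  [set i in R | [forall j in T, A i j == 0]]%SET.

(** The matrix is block triangular. Scaling the columns outside [T] by a small [c] puts their
    entries in the rows [rho1] below the diagonal terms; remaining ties are ordered by shifting the
    ranks on [T] above all others. *)
Lemma nonsingular_glue R S T rho1 rho2 : T \subset S ->
  nonsingular_rows R T rho1 ->
  nonsingular_rows (rows_vanishing_on R T) (S :\: T) rho2 ->
  exists rho, nonsingular_rows R S rho.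
Proof.
move=> TS [v1 [r1 cert1]] [v2 [r2 cert2]].
have [x|c c0 cP] := @exists_small_scalar (J * J)%type
  (fun x => A (rho1 x.1) x.2 * v2 x.2)
  (fun x => if x.1 \in T then A (rho1 x.1) x.1 * v1 x.1 else 1).
  case: ifPn => [/cert1[_ Ax vx _]|_]; last exact: oner_neq0.
  by rewrite idem_mulf_neq0 Ax.
exists (fun j => if j \in T then rho1 j else rho2 j).
exists (fun j => if j \in T then v1 j else c * v2 j).
exists (fun j => if j \in T then (r1 j + (\max_k r2 k).+1)%N else r2 j) => j jS.
case: ifPn => [jT|jT].
  have [rR Aj vj jk] := cert1 j jT; split=> // k kS kj.
  case: ifPn => [kT|kT]; first by rewrite ltn_add2r; apply: jk.
  split=> [|_]; last first.
    by rewrite addnS ltnS; apply: leq_trans (leq_addl _ _); apply: (leq_bigmax k).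
  by have := cP (j, k); rewrite /= jT mulrCA.
have [|rZ Aj vj jk] := cert2 j; first by rewrite !inE jT.
have [rR /forallP rT] : rho2 j \in R /\ [forall j' in T, A (rho2 j) j' == 0].
  by move: rZ; rewrite !inE => /andP[].
split=> // [|k kS kj]; first by rewrite idem_mulf_neq0 c0.
case: ifPn => [kT|kT]; last first.
  have [|le lt] := jk k _ kj; first by rewrite !inE kT.
  rewrite !(mulrCA _ c); split; first exact: le_idem_mul2l.
  by move/(le_idem_mulI c0).
have /eqP-> := implyP (rT k) kT; rewrite mul0r; split; first exact: le0_idem.
move/le_idem0/eqP; rewrite -[_ == 0]negbK !idem_mulf_neq0.
by rewrite Aj c0 vj.
Qed.

(** For small [c] the term [c * w] does not exceed a nonzero row maximum of [u], so the ties of [u]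
    persist. In the other rows only [w] contributes. *)
Lemma solves_perturb R u w : solves R u ->
  (forall i, i \in R -> row_max u i = 0 -> balanced (fun j => A i j * w j)) ->
  exists2 c, c != 0 & solves R (fun j => u j + c * w j).
Proof.
move=> sol wbal.
have [i|c c0 cP] := @exists_small_scalar I (row_max w)
  (fun i => if row_max u i != 0 then row_max u i else 1).
  by case: ifP => // _; apply: oner_neq0.
exists c => // i iR j; move: (cP i); case: eqVneq => /= [ui _|ui le].
  have Au k : A i k * u k = 0 by apply: le_idem0; rewrite -ui le_row_max.
  rewrite mulrDr Au add0r mulrCA idem_mulf_neq0 c0 /= => /(wbal i iR ui)[k kj lek].
  by exists k => //; rewrite !mulrDr !Au !add0r !(mulrCA _ c) le_idem_mul2l.
move=> _; have [e ej att] : exists2 e, e != j & attains u i e.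
  have [e att] := exists_attains ui; have [ee|ej] := eqVneq e j; last by exists e.
  by rewrite ee in att; apply: balanced_attains att; apply: sol.
exists e => //; rewrite [X in _ <=+ X]mulrDr (attains_row_max att).
apply: le_idem_trans (le_idem_addl _ _); rewrite mulrDr.
apply: add_le_idem; first exact: le_row_max.
rewrite mulrCA; apply: le_idem_trans le; apply: le_idem_mul2l; exact: le_row_max.
Qed.

Lemma not_trivial_kernel R S : ~ trivial_kernel R S ->
  exists u, [/\ forall j, j \notin S -> u j = 0, solves R u & exists j, u j != 0].
Proof.
move=> ntriv; apply: contrapT => no; apply: ntriv => u uS sol j.
by apply/eqP/negPn/negP => uj; apply: no; exists u; split=> //; exists j.
Qed.

(* If the support T of a solution is maximal and proper, a solution on [S :\: T]
   of the rows vanishing on T can be added after scaling it down. *)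
Lemma full_support_solution R S :
  (forall T, T \subset S -> T != finset.set0 -> T != S ->
     ~ trivial_kernel (rows_vanishing_on R T) (S :\: T)) ->
  ~ trivial_kernel R S ->
  exists2 u, forall j, (u j != 0) = (j \in S) & solves R u.
Proof.
move=> Tker /not_trivial_kernel[u0 [u0S sol0 [j0 uj0]]].
pose P T := (T \subset S) &&
  `[< exists2 u, forall j, (u j != 0) = (j \in T) & solves R u >].
have P0 : P [set j | u0 j != 0]%SET.
  apply/andP; split; last by apply/asboolP; exists u0 => // j; rewrite inE.
  by apply/fintype.subsetP => j; rewrite inE; apply: contraR => /u0S->.
have [T /maxsetP[/andP[TS /asboolP[u uT sol]] Tmax] T0T] := maxset_exists P0.
have [<-|neqTS] := eqVneq T S; first by exists u.
have j0T : j0 \in T by apply: (fintype.subsetP T0T); rewrite inE.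
have Tn0 : T != finset.set0 by apply/set0Pn; exists j0.
have [w [wS wsol [j1 wj1]]] := not_trivial_kernel (Tker T TS Tn0 neqTS).
have wST j : w j != 0 -> j \in S :\: T by apply: contraR => /wS->.
have [i iR ui|c c0 solc] := @solves_perturb R u w sol.
  apply: wsol; rewrite !inE iR; apply/forallP => j; apply/implyP => jT.
  have : A i j * u j = 0 by apply: le_idem0; rewrite -ui le_row_max.
  by move/eqP; rewrite -[_ == 0]negbK idem_mulf_neq0 uT jT andbT negbK.
pose T' := [set j | u j + c * w j != 0]%SET.
have T'T : T' = T.
  apply: Tmax; last first.
    apply/fintype.subsetP => j; rewrite -uT inE; exact/le_idem_neq0/le_idem_addl.
  apply/andP; split; last first.
    by apply/asboolP; exists (fun j => u j + c * w j) => // j; rewrite inE.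
  apply/fintype.subsetP => j; rewrite inE.
  have [jT _|jT] := boolP (j \in T); first exact: (fintype.subsetP TS).
  have -> : u j = 0 by apply/eqP; rewrite -[_ == 0]negbK uT.
  rewrite add0r idem_mulf_neq0 => /andP[_ /wST].
  by rewrite inE => /andP[].
have := wST j1 wj1; rewrite -T'T !inE => /andP[/negP[]].
apply: le_idem_neq0 (le_idem_addr _ _) _.
by rewrite idem_mulf_neq0 c0.
Qed.

Lemma trivial_kernel_nonsingular (i0 : I) R S : trivial_kernel R S ->
  exists rho, nonsingular_rows R S rho.
Proof.
have [N] := ubnP #|S|; elim: N => // N IHS in R S *; rewrite ltnS => leS.
have [M] := ubnP #|R|; elim: M => // M IHR in R *; rewrite ltnS => leR triv.
have [S0|/set0Pn[j0 j0S]] := eqVneq S finset.set0.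
  by exists (fun=> i0), (fun=> 1), (fun=> 0%N) => j; rewrite S0 inE.
have [R0|/set0Pn[m mR]] := eqVneq R finset.set0.
  (* Without rows, the indicator of [S] lies in the kernel. *)
  have : (j0 \in S)%:R = 0 :> K.
    apply: (triv (fun j => (j \in S)%:R)) => [j /negPf->//|i].
    by rewrite R0 inE.
  by rewrite j0S => /eqP; rewrite oner_eq0.
have [triv'|ntriv] := pselect (trivial_kernel (R :\ m) S).
  have [|rho [v [r cert]]] := IHR (R :\ m) _ triv'.
    by rewrite (leq_trans _ leR) // [X in (_ < X)%N](cardsD1 m) mR.
  exists rho, v, r => j /cert[]; rewrite !inE => /andP[_ ? ? ? ?]; by split.
have [[T [TS T0 neqTS trivT]]|noT] := pselect (exists T,
  [/\ T \subset S, T != finset.set0, T != S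
    & trivial_kernel (rows_vanishing_on R T) (S :\: T)]).
  have ltT : (#|T| < #|S|)%N by apply: proper_card; rewrite finset.properEneq neqTS.
  have [|rho1 cert1] := IHS R T (leq_trans ltT leS).
    move=> u uT; apply: triv => j jS; apply: uT.
    by apply: contra jS; apply: (fintype.subsetP TS).
  have [|rho2 cert2] := IHS _ (S :\: T) _ trivT; last first.
    exact: nonsingular_glue cert1 cert2.
  apply: leq_trans leS; rewrite cardsDS // ltn_subrL !card_gt0 T0 /=.
  by apply/set0Pn; exists j0.
have [T TS T0 neqTS|u uS sol] := @full_support_solution (R :\ m) S _ ntriv.
  move=> trivT; apply: noT; exists T; split=> // u uST solu.
  apply: trivT => // i; rewrite !inE -andbA => /and3P[_ iR Ai].
  by apply: solu; rewrite inE iR.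
have [|j1 attm uniqm] := @not_balanced_attains u m.
  move=> bal; have : u j0 = 0; last by apply/eqP; rewrite uS.
  apply: triv => [j|i iR]; first by rewrite -uS negbK => /eqP.
  by have [->//|im] := eqVneq i m; apply: sol; rewrite !inE im.
by apply: (@nearly_solved_nonsingular R S m j1 u).
Qed.

End Matrix.

(** * Regularity in coordinates *)

Section Coordinates.
Context (E : lSemiModType K) (I : finType) (e : I -> E).
Context (coord : E -> {ffun I -> K^o}).
Hypotheses (coordK : cancel (lincomb e) coord) (lincombK : cancel coord (lincomb e)).

Lemma coord_inj u v : (forall i, coord u i = coord v i) -> u = v.
Proof. by move=> uv; apply: (can_inj lincombK); apply/ffunP. Qed.

Lemma coordD u v i : coord (u + v) i = coord u i + coord v i.
Proof.
suff -> : u + v = lincomb e (coord u + coord v) by rewrite coordK ffunE.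
by rewrite raddfD /= !lincombK.
Qed.

Lemma coordZ a u i : coord (a *: u) i = a * coord u i.
Proof.
suff -> : a *: u = lincomb e (a *: coord u) by rewrite coordK ffunE.
by rewrite linearZ /= lincombK.
Qed.

Lemma coord0 i : coord 0 i = 0.
Proof. by rewrite -(scale0r 0) coordZ mul0r. Qed.

Lemma coord_sum (T : finType) (F : T -> E) i :
  coord (\sum_t F t) i = \sum_t coord (F t) i.
Proof.
by apply: (big_morph (fun v => coord v i)) => [u v|]; [exact: coordD | exact: coord0].
Qed.

Lemma coord_comb (c : I -> K) i : coord (\sum_k c k *: e k) i = c i.
Proof.
have -> : \sum_k c k *: e k = lincomb e [ffun k => c k].
  by apply: eq_bigr => k _; rewrite ffunE.
by rewrite coordK ffunE.
Qed.

Lemma coord_basis k i : coord (e k) i = (i == k)%:R.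
Proof.
rewrite -[RHS](coord_comb (fun i => (i == k)%:R)); congr (coord _ i).
rewrite (bigD1 k) //= eqxx scale1r.
by rewrite big1 ?addr0 // => l /negPf->; rewrite scale0r.
Qed.

Lemma linear_form_coord (l : {linear E -> K^o}) u :
  l u = \sum_i l (e i) * coord u i :> K.
Proof.
rewrite -{1}[u]lincombK /lincomb linear_sum; apply: eq_bigr => i _.
by rewrite linearZ mulrC.
Qed.

Lemma common_lower_bound (a b : K) : a != 0 -> b != 0 ->
  exists m, [/\ m != 0, a + m = a & b + m = b].
Proof.
case/orP: (le_idem_total a b) => /eqP ab a0 b0.
  by exists a; rewrite K_semifield.2 addrC ab.
by exists b; rewrite K_semifield.2 addrC ab.
Qed.

Lemma add_absorb0 (a b c : K) : a = 0 \/ b = 0 -> a + c = a -> b + c = b -> c = 0.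
Proof. by case=> -> h1 h2; rewrite add0r in h1 h2 *. Qed.

(** Two nonzero coordinates at [i] would both absorb their minimum [m], so [m *: e i] would
    contradict orthogonality. *)
Lemma orthogonal_coord u v : Defs.orthogonal u v ->
  forall i, coord u i = 0 \/ coord v i = 0.
Proof.
move=> uv i; have [->|u0] := eqVneq (coord u i) 0; first by left.
right; apply/eqP/negPn/negP => v0.
have [m [m0 um vm]] := common_lower_bound u0 v0.
have absorb w : coord w i + m = coord w i -> w + m *: e i = w.
  move=> wm; apply: coord_inj => k; rewrite coordD coordZ coord_basis.
  by case: eqVneq => [->|_]; rewrite ?mulr1 ?mulr0 ?addr0.
have := uv (m *: e i) (absorb u um) (absorb v vm).
move/(congr1 (fun w => coord w i)); rewrite coordZ coord_basis eqxx mulr1 coord0.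
by apply/eqP.
Qed.

Section Families.
Context (J : finType).

Definition unit_ffun (j : J) : {ffun J -> K^o} := [ffun k => (k == j)%:R].

Lemma sum_unit_ffun (c : {ffun J -> K^o}) : c = \sum_j (c j : K) *: unit_ffun j.
Proof.
apply/ffunP => k; rewrite sum_ffunE (bigD1 k) //= !ffunE eqxx big1 ?addr0 => [|j jk].
  by rewrite /GRing.scale /= mulr1.
by rewrite !ffunE eq_sym (negPf jk) /GRing.scale /= mulr0.
Qed.

Lemma lincomb_unit_ffun (f : J -> E) j : lincomb f (unit_ffun j) = f j.
Proof.
rewrite /lincomb (bigD1 j) //= ffunE eqxx scale1r big1 ?addr0 // => k /negPf kj.
by rewrite ffunE kj scale0r.
Qed.

(* Fixes the scalars to [K]: unification would otherwise take [K^o]. *)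
Definition lincomb_map (f : J -> E) : {linear {ffun J -> K^o} -> E} :=
  @lincomb K E J f.

Lemma lincomb_map_unit (f : J -> E) j : lincomb_map f (unit_ffun j) = f j.
Proof. exact: lincomb_unit_ffun. Qed.

Lemma coord_linear (g : {linear {ffun J -> K^o} -> E}) c i :
  coord (g c) i = \sum_j coord (g (unit_ffun j)) i * c j.
Proof.
rewrite {1}[c]sum_unit_ffun linear_sum coord_sum; apply: eq_bigr => j _.
by rewrite linearZ coordZ mulrC.
Qed.

Lemma linear_unit_ext (g h : {linear {ffun J -> K^o} -> E}) :
  (forall i j, coord (g (unit_ffun j)) i = coord (h (unit_ffun j)) i) -> g = h.
Proof.
move=> gh; apply: linear_map_ext => c; apply: coord_inj => i.
by rewrite !coord_linear; apply: eq_bigr => j _; rewrite gh.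
Qed.

Lemma orthogonal_linearP (g h : {linear {ffun J -> K^o} -> E}) :
  Defs.orthogonal g h <->
  forall i j, coord (g (unit_ffun j)) i = 0 \/ coord (h (unit_ffun j)) i = 0.
Proof.
split=> [gh i j|gh z gz hz]; last first.
  apply: linear_unit_ext => i j; rewrite [RHS]coord0.
  apply: add_absorb0 (gh i j) _ _; rewrite -coordD.
    by rewrite -[in RHS]gz.
  by rewrite -[in RHS]hz.
have [->|g0] := eqVneq (coord (g (unit_ffun j)) i) 0; first by left.
right; apply/eqP/negPn/negP => h0.
have [m [m0 gm hm]] := common_lower_bound g0 h0.
pose y k := ((k == j)%:R * m) *: e i.
pose z := lincomb_map y.
have absorb (w : {linear {ffun J -> K^o} -> E}) :
    coord (w (unit_ffun j)) i + m = coord (w (unit_ffun j)) i -> w + z = w.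
  move=> wm; apply: linear_unit_ext => i' j'.
  rewrite [LHS](coordD (w (unit_ffun j')) (z (unit_ffun j'))).
  rewrite lincomb_map_unit coordZ coord_basis.
  case: (eqVneq j' j) => [->|_]; last by rewrite !mul0r addr0.
  by case: eqVneq => [->|_]; rewrite ?mul1r ?mulr1 ?mulr0 ?addr0.
have /(congr1 (fun w : {linear {ffun J -> K^o} -> E} => coord (w (unit_ffun j)) i)) :=
  gh z (absorb g gm) (absorb h hm).
rewrite [RHS]coord0 lincomb_map_unit coordZ coord_basis !eqxx mul1r mulr1.
by apply/eqP.
Qed.

(** Given a solution [u], a decomposition singular at [u] is obtained by separating from each row
    [i] one entry [a i] with maximal term; balance makes the rest reach the same maximum. The
    converse is [balanced_add] applied row by row. *)
Lemma regular_familyP (f : J -> E) : regular_family f <->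
  trivial_kernel (fun i j => coord (f j) i) finset.setT finset.setT.
Proof.
split=> [reg u _ sol j0|triv].
  have /choice[a aP] : forall i, exists j, forall k,
      coord (f k) i * u k <=+ coord (f j) i * u j.
    move=> i; have [j _ jP] := @exists_le_idem_max J xpredT
      (fun k => coord (f k) i * u k) j0 isT.
    by exists j => k; apply: jP.
  pose f1 j := \sum_i (if a i == j then coord (f j) i else 0) *: e i.
  pose f2 j := \sum_i (if a i == j then 0 else coord (f j) i) *: e i.
  have f1E i j : coord (f1 j) i = if a i == j then coord (f j) i else 0.
    exact: coord_comb.
  have f2E i j : coord (f2 j) i = if a i == j then 0 else coord (f j) i.
    exact: coord_comb.
  suff : Tker (lincomb_map f) [ffun j => u j].
    by rewrite (reg : Tker _ = _) => /ffunP/(_ j0); rewrite !ffunE.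
  exists (lincomb_map f1), (lincomb_map f2).
  split; first split.
  - apply: linear_unit_ext => i j.
    rewrite [RHS](coordD (lincomb_map f1 _) (lincomb_map f2 _)).
    rewrite !lincomb_map_unit f1E f2E.
    by case: ifP; rewrite ?addr0 ?add0r.
  - apply/orthogonal_linearP => i j.
    by rewrite !lincomb_map_unit f1E f2E; case: ifP; [right | left].
  apply: coord_inj => i; rewrite !coord_linear.
  under eq_bigr do rewrite lincomb_map_unit f1E ffunE.
  under [RHS]eq_bigr do rewrite lincomb_map_unit f2E ffunE.
  rewrite (bigD1 (a i)) //= eqxx big1 ?addr0; last first.
    by move=> j /negPf ja; rewrite eq_sym ja mul0r.
  apply: le_idem_anti; apply/andP; split; last first.
    apply: sum_le_idem => j; case: ifP => _; first by rewrite mul0r le0_idem.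
    exact: aP.
  have [->|nz] := eqVneq (coord (f (a i)) i * u (a i)) 0; first exact: le0_idem.
  have [k ka lek] := sol i (finset.in_setT i) (a i) nz.
  apply: le_idem_trans lek _.
  apply: le_idem_trans (le_idem_sum _ k).
  by rewrite eq_sym (negPf ka) le_idem_refl.
apply/seteqP; split=> [c [f1 [f2 [[def orth] eqc]]]|_ ->]; last first.
  exists (lincomb_map f), 0; split; last by rewrite linear0.
  split; first by rewrite addr0.
  by move=> z _; rewrite add0r.
apply/ffunP => j; rewrite ffunE; apply: triv j => [j|i _].
  by rewrite finset.in_setT.
have -> : (fun j => coord (f j) i * c j) = (fun j =>
    coord (f1 (unit_ffun j)) i * c j + coord (f2 (unit_ffun j)) i * c j).
  apply/funext => j.
  by rewrite -mulrDl -coordD -[f j]lincomb_map_unit [lincomb_map f]def.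
apply: balanced_add => [j|]; last by rewrite -!coord_linear eqc.
by have [->|->] := (orthogonal_linearP f1 f2).1 orth i j; rewrite mul0r; [left | right].
Qed.

Lemma weakly_generating_setT (f : J -> E) :
  (forall l : I -> K, (forall j, balanced (fun i => l i * coord (f j) i)) ->
     forall i, l i = 0) ->
  weakly_generating f [set: E]%classic.
Proof.
move=> triv; apply/seteqP; split=> // v _ l fl.
have l0 : forall i, l (e i) = 0.
  apply: (triv (fun i => l (e i))) => j.
  have [|u1 [u2 [[def orth] eql]]] := fl (f j).
    by exists (unit_ffun j) => //; rewrite lincomb_unit_ffun.
  have -> : (fun i => l (e i) * coord (f j) i) = (fun i =>
      l (e i) * coord u1 i + l (e i) * coord u2 i).
    by apply/funext => i; rewrite def coordD mulrDr.
  apply: balanced_add => [i|]; last by rewrite -!linear_form_coord.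
  by have [->|->] := orthogonal_coord orth i; rewrite mulr0; [left | right].
have lz u : l u = 0.
  by rewrite linear_form_coord big1 // => i _; rewrite l0 mul0r.
exists v, 0; split; last by rewrite !lz.
by split; [rewrite addr0 | move=> z _; rewrite add0r].
Qed.

End Families.
End Coordinates.

End Semifield.

(** * Completion of a regular family *)

Local Open Scope classical_set_scope.
Local Open Scope ring_scope.

Theorem mainTheorem1 (K : comNzSemiRingType)
    (K_semifield : idempotent_semifield K) (K_total : totally_ordered K)
    (E : lSemiModType K) (n : nat) (e : 'I_n -> E) (e_basis : is_basis e)
    (p : nat) (f : 'I_p -> E) (f_regular : regular_family f) :
  (p <= n)%N /\
  exists s : 'I_(n - p) -> 'I_n,
    injective s /\
    tropical_basis (family_cat f (fun j => e (s j))) [set: E].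
Proof.
have [coord coordK lincombK] := e_basis.
pose A i j : K := coord (f j) i.
have triv : trivial_kernel A finset.setT finset.setT :=
  (regular_familyP K_semifield K_total coordK lincombK f).1 f_regular.
have [rho cert] : exists rho : 'I_p -> 'I_n,
    nonsingular_rows A finset.setT finset.setT rho.
  have [i0 _|no_row] := pickP (fun _ : 'I_n => true).
    exact (trivial_kernel_nonsingular K_semifield K_total i0 triv).
  (* Without rows the constant vector 1 is in the kernel, so there are no columns either. *)
  have no_col (j : 'I_p) : False.
    have : (1 : K) = 0; last by apply/eqP; rewrite oner_neq0.
    by apply: (triv (fun=> 1)) j => [j|i]; [rewrite finset.in_setT | have := no_row i].
  by exists (fun j => match no_col j with end), (fun=> 1), (fun=> 0%N) => j.
have rho_inj : injective rho.
  by move=> j k; apply: (nonsingular_rows_inj cert); apply: finset.in_setT.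
have le_pn : (p <= n)%N by have := leq_card rho rho_inj; rewrite !card_ord.
split=> //.
pose C := (~: [set rho j | j : 'I_p])%SET.
have cardC : (n - p)%N = #|C|.
  by rewrite cardsCs finset.setCK card_ord card_imset // card_ord.
pose s k : 'I_n := enum_val (cast_ord cardC k).
have s_inj : injective s by move=> k l /enum_val_inj/cast_ord_inj.
have rho_s j k : rho j != s k.
  have : s k \in C := enum_valP _.
  by rewrite inE; apply: contraNneq => <-; apply: imset_f.
have s_onto i : (forall j, rho j != i) -> exists k, i = s k.
  move=> rho_i; have iC : i \in C.
    by rewrite inE; apply/imsetP => -[j _ ij]; have := rho_i j; rewrite ij eqxx.
  exists (cast_ord (esym cardC) (enum_rank_in iC i)).
  by rewrite /s cast_ordKV enum_rankK_in.
exists s; split=> //; split.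
  apply/(regular_familyP K_semifield K_total coordK lincombK) => u _ sol.
  (* The adjoined vectors vanish in the rows [rho j], so these rows constrain the coefficients of
     [f] alone. *)
  have u_inl j : u (inl j) = 0.
    move: j; apply: (nonsingular_kernel (u := fun j => u (inl j))
      K_semifield K_total cert) => [j|j _ k nz].
      by rewrite finset.in_setT.
    have [[l|l] ljk le] := sol (rho j) (finset.in_setT _) (inl k) nz.
      by exists l => //; apply: contra ljk => /eqP->.
    move: nz; apply: contra_neqP => _; apply: le_idem0.
    move: le; rewrite /= (coord_basis coordK).
    by rewrite (negPf (rho_s j l)) mul0r.
  (* With the coefficients of [f] zero, row [s k] has the single term [u (inr k)]. *)
  have u_inr k : u (inr k) = 0.
    apply/eqP/negPn/negP => uk.
    have [|[l|l] lk] := sol (s k) (finset.in_setT _) (inr k) _.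
    - by rewrite /= (coord_basis coordK) eqxx mul1r.
    - rewrite u_inl mulr0 /= (coord_basis coordK) eqxx mul1r.
      by move/le_idem0/eqP; apply/negP.
    rewrite /= !(coord_basis coordK) eqxx mul1r (inj_eq s_inj).
    have -> : (k == l) = false by apply: contraNF lk => /eqP->.
    by rewrite mul0r => /le_idem0/eqP; apply/negP.
  by case.
apply: (weakly_generating_setT K_semifield K_total coordK lincombK) => l lbal.
apply: (nonsingular_cokernel K_semifield K_total cert) => [i|j]; last first.
  exact: (lbal (inl j)).
(* The column of [e (s k)] has a single nonzero entry, so balance forces [l] to vanish at [s k]. *)
move=> /s_onto[k ik]; rewrite {i}ik; apply/eqP/negPn/negP => lk.
have [|i ik] := lbal (inr k) (s k).
  by rewrite /= (coord_basis coordK) eqxx mulr1.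
rewrite /= !(coord_basis coordK) (negPf ik) eqxx mulr1 mulr0.
by move/le_idem0/eqP; apply/negP.
Qed.
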